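(* Let $R$ be a noetherian normal domain and let $M$ be a finite torsion-free $R$-module. Then $\Gamma(R_{\mathrm{div}},M_{\mathrm{div}})=M^{\vee\vee}$, the reflexive hull of $M$.
   Context: For a scheme $X$ let $X^{(1)}=\{x\in X:\dim\mathcal O_{X,x}\le1\}$. The divisorial topology on $X$ is the Grothendieck topology whose objects are the Zariski open subsets of $X$ and where $U_i\to U$, $i\in I$, is a covering if $U^{(1)}\subseteq\bigcup_{i\in I}U_i$. $R_{\mathrm{div}}$ denotes $\operatorname{Spec} R$ with the divisorial topology, and $M_{\mathrm{div}}$ is the sheafification in this topology of the presheaf $U\mapsto\Gamma(U,\widetilde M)$. $M^\vee=\operatorname{Hom}_R(M,R)$ and $M^{\vee\vee}$ is the bidual; the identification is compatible with the natural maps from $M$. *)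

(* Defs.v *)
From HB Require Import structures.
From mathcomp Require Import all_boot all_algebra.
From mathcomp Require Import generic_quotient ring_quotient.
From mathcomp Require Import all_classical topology.
From mathcomp Require Import ring.

Set Implicit Arguments.
Unset Strict Implicit.
Unset Printing Implicit Defensive.

Import GRing.Theory.
Local Open Scope ring_scope.
Local Open Scope quotient_scope.
Local Open Scope classical_set_scope.

Definition noetherian (R : comNzRingType) : Prop :=
  forall I : set R,
    I 0 -> (forall a u v, I u -> I v -> I (a * u + v)) ->
    exists (n : nat) (g : 'I_n -> R),
      I = [set x | exists c : 'I_n -> R, x = \sum_(i < n) c i * g i].

Definition normal_domain (R : idomainType) : Prop :=
  forall z : {fraction R},
    integralOver (@tofrac R) z -> exists x : R, z = tofrac x.

Definition finite_module (R : nzRingType) (M : lmodType R) : Prop :=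
  exists (n : nat) (g : 'I_n -> M),
    forall x, exists c : 'I_n -> R, x = \sum_(i < n) c i *: g i.

Definition torsion_free (R : idomainType) (M : lmodType R) : Prop :=
  forall (a : R) (x : M), a *: x = 0 -> a = 0 \/ x = 0.

Section Spectrum.
Variable R : comNzRingType.

(* Every subset is decidable in the classical setting, so boolean predicates
   give all the prime ideals; [idealr_closed] includes properness. *)
Record spec : Type := Spec {
  in_prime : R -> bool;
  spec_ideal : idealr_closed in_prime;
  spec_prime : prime_idealr_closed in_prime }.
HB.instance Definition _ := gen_eqMixin spec.
HB.instance Definition _ := gen_choiceMixin spec.

Definition nonvanishing (E : set R) : set spec :=
  [set p | exists2 f, E f & f \notin in_prime p].

Definition zariski_open (U : set spec) : Prop := exists E, U = nonvanishing E.

Lemma prime_notin1 (p : spec) : 1 \notin in_prime p.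
Proof. by case: (spec_ideal p). Qed.

Lemma prime_notin_mul (p : spec) (s t : R) :
  (s * t \notin in_prime p) = (s \notin in_prime p) && (t \notin in_prime p).
Proof.
have [p0 _ pD] := spec_ideal p; rewrite -negb_or; congr (~~ _).
apply/idP/orP => [/spec_prime/orP //|[sp|tp]].
  by rewrite mulrC -[_ * _]addr0 pD.
by rewrite -[_ * _]addr0 pD.
Qed.

Lemma prime_notinM (p : spec) (s t : R) :
  s \notin in_prime p -> t \notin in_prime p -> s * t \notin in_prime p.
Proof. by rewrite prime_notin_mul => -> ->. Qed.

Let zariski_openT : zariski_open setT.
Proof.
exists [set 1]; apply/seteqP; split=> // p _; exists 1 => //.
exact: prime_notin1.
Qed.

Let zariski_openI : setI_closed zariski_open.
Proof.
move=> _ _ [E ->] [F ->].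
exists [set h | exists f g, [/\ E f, F g & h = f * g]].
apply/seteqP; split=> p.
  move=> [[f Ef fp] [g Fg gp]]; exists (f * g); first by exists f, g.
  exact: prime_notinM.
move=> [_ [f [g [Ef Fg ->]]]]; rewrite prime_notin_mul => /andP[fp gp].
by split; [exists f | exists g].
Qed.

Let zariski_open_bigU (I : Type) (U : I -> set spec) :
  (forall i, zariski_open (U i)) -> zariski_open (\bigcup_i U i).
Proof.
move=> oU; have [E hE] := choice oU; exists (\bigcup_i E i).
apply/seteqP; split=> p.
  by move=> [i _]; rewrite hE => -[f Ef fp]; exists f => //; exists i.
by move=> [f [i _ Ef] fp]; exists i => //; rewrite hE; exists f.
Qed.

HB.instance Definition _ :=
  isOpenTopological.Build spec zariski_openT zariski_openI zariski_open_bigU.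

Lemma zariski_openE (U : set spec) : open U = zariski_open U.
Proof. by []. Qed.

Record opens : Type := Opens { oset :> set spec; osetP : open oset }.

Definition openX : opens := Opens openT.
Definition opens_cap (U V : opens) : opens := Opens (openI (osetP U) (osetP V)).

(* No chain c 0 < c 1 < ... < c n.+1 of primes. *)
Definition krull_dim_le (n : nat) : Prop :=
  ~ exists c : nat -> spec, forall i : nat, (i <= n)%N ->
      {subset in_prime (c i) <= in_prime (c i.+1)} /\
      ~ {subset in_prime (c i.+1) <= in_prime (c i)}.

End Spectrum.

Section Localization.
Variables (R : comNzRingType) (p : spec R).

Record denom : Type := Denom { den :> R; den_notin : den \notin in_prime p }.
HB.instance Definition _ := [isSub for den].
HB.instance Definition _ := [Choice of denom by <:].

Definition denom1 : denom := Denom (prime_notin1 p).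
Definition denomM (s t : denom) : denom :=
  Denom (prime_notinM (den_notin s) (den_notin t)).

Section Module.
Variable M : lmodType R.

Definition loc_eq (x y : M * denom) : bool :=
  `[< exists u : denom,
        den u *: (den y.2 *: x.1) = den u *: (den x.2 *: y.1) >].

Lemma loc_eq_equiv : equiv_class_of loc_eq.
Proof.
split=> [x|x y|y x z]; first by apply/asboolP; exists denom1.
  by apply/asboolP/asboolP => -[u h]; exists u.
move=> /asboolP[u h] /asboolP[v k]; apply/asboolP.
exists (denomM (denomM u v) y.2) => /=.
rewrite !scalerA in h k *.
have -> : den u * den v * den y.2 * den z.2 = den v * den z.2 * (den u * den y.2)
  by ring.
rewrite -scalerA h scalerA.
have -> : den v * den z.2 * (den u * den x.2) = den u * den x.2 * (den v * den z.2)
  by ring.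
by rewrite -scalerA k scalerA; congr (_ *: _); ring.
Qed.

Canonical loc_equiv := EquivRelPack loc_eq_equiv.

(* The localization M_p, as a module over R. *)
Definition loc : Type := {eq_quot loc_eq}.
HB.instance Definition _ : EqQuotient _ loc_eq loc := EqQuotient.on loc.
HB.instance Definition _ := Choice.on loc.

Definition frac (m : M) (s : denom) : loc := \pi_loc (m, s).

Lemma frac_eqP (m n : M) (s t : denom) :
  frac m s = frac n t <->
  exists u : denom, den u *: (den t *: m) = den u *: (den s *: n).
Proof.
by split=> [/eqmodP /asboolP //|h]; apply/eqmodP/asboolP.
Qed.

Lemma fracW (P : loc -> Prop) : (forall m s, P (frac m s)) -> forall x, P x.
Proof. by move=> h; elim/quotW => -[m s]; exact: h. Qed.

Let rep (x : loc) : M * denom := repr x.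

Let repE x : frac (rep x).1 (rep x).2 = x.
Proof. by rewrite /frac -surjective_pairing; exact: reprK. Qed.

Definition loc0 : loc := frac 0 denom1.
Definition loc_opp (x : loc) : loc := frac (- (repr x).1) (repr x).2.
Definition loc_add (x y : loc) : loc :=
  frac (den (repr y).2 *: (repr x).1 + den (repr x).2 *: (repr y).1)
       (denomM (repr x).2 (repr y).2).
Definition loc_scale (a : R) (x : loc) : loc := frac (a *: (repr x).1) (repr x).2.

Lemma loc_oppE m s : loc_opp (frac m s) = frac (- m) s.
Proof.
have /frac_eqP[u h] := repE (frac m s).
by apply/frac_eqP; exists u; rewrite !scalerN; congr (- _).
Qed.

Lemma loc_scaleE a m s : loc_scale a (frac m s) = frac (a *: m) s.
Proof.
have /frac_eqP[u h] := repE (frac m s).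
have sw (v w : R) (n : M) : v *: (w *: (a *: n)) = a *: (v *: (w *: n)).
  by rewrite !scalerA; congr (_ *: _); ring.
by apply/frac_eqP; exists u; rewrite !sw -h.
Qed.

Lemma loc_addE m n s t :
  loc_add (frac m s) (frac n t) = frac (den t *: m + den s *: n) (denomM s t).
Proof.
have /frac_eqP[u h] := repE (frac m s).
have /frac_eqP[v k] := repE (frac n t).
rewrite /rep in h k.
set x := repr (frac m s) in h *; set y := repr (frac n t) in k *.
apply/frac_eqP; exists (denomM u v) => /=.
rewrite !scalerDr !scalerA in h k *; congr (_ + _).
  have -> : den u * den v * (den s * den t) * den y.2
          = den v * den t * den y.2 * (den u * den s) by ring.
  by rewrite -scalerA h scalerA; congr (_ *: _); ring.
have -> : den u * den v * (den s * den t) * den x.2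
        = den u * den s * den x.2 * (den v * den t) by ring.
by rewrite -scalerA k scalerA; congr (_ *: _); ring.
Qed.

Let loc_addA : associative loc_add.
Proof.
elim/fracW=> m s; elim/fracW=> n t; elim/fracW=> k u; rewrite !loc_addE.
apply/frac_eqP; exists denom1 => /=.
rewrite !scalerDr !scalerA -!addrA.
by congr (_ *: _ + (_ *: _ + _ *: _)); ring.
Qed.

Let loc_addC : commutative loc_add.
Proof.
elim/fracW=> m s; elim/fracW=> n t; rewrite !loc_addE.
apply/frac_eqP; exists denom1 => /=.
by rewrite !scalerDr !scalerA addrC; congr (_ *: _ + _ *: _); ring.
Qed.

Let loc_add0 : left_id loc0 loc_add.
Proof.
elim/fracW=> m s; rewrite loc_addE scaler0 add0r.
by apply/frac_eqP; exists denom1; rewrite /= !scale1r mul1r.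
Qed.

Let loc_addN : left_inverse loc0 loc_opp loc_add.
Proof.
elim/fracW=> m s; rewrite loc_oppE loc_addE scalerN addNr.
by apply/frac_eqP; exists denom1; rewrite !scaler0.
Qed.

HB.instance Definition _ :=
  GRing.isZmodule.Build loc loc_addA loc_addC loc_add0 loc_addN.

Lemma fracD m n s t :
  frac m s + frac n t = frac (den t *: m + den s *: n) (denomM s t).
Proof. exact: loc_addE. Qed.

Let loc_scaleA a b x : loc_scale a (loc_scale b x) = loc_scale (a * b) x.
Proof. by elim/fracW: x => m s; rewrite !loc_scaleE scalerA. Qed.

Let loc_scale1 : left_id 1 loc_scale.
Proof. by elim/fracW=> m s; rewrite loc_scaleE scale1r. Qed.

Let loc_scaleDr : right_distributive loc_scale +%R.
Proof.
move=> a; elim/fracW=> m s; elim/fracW=> n t; rewrite fracD !loc_scaleE fracD; congr frac.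
by rewrite scalerDr !scalerA ![a * _]mulrC.
Qed.

Let loc_scaleDl x : {morph loc_scale^~ x : a b / a + b}.
Proof.
elim/fracW: x => m s a b; rewrite !loc_scaleE fracD.
apply/frac_eqP; exists denom1 => /=.
rewrite -scalerDr -scalerDl !scalerA; congr (_ *: _); ring.
Qed.

HB.instance Definition _ :=
  GRing.Zmodule_isLmodule.Build R loc loc_scaleA loc_scale1 loc_scaleDr loc_scaleDl.

Lemma fracZ a m s : a *: frac m s = frac (a *: m) s.
Proof. exact: loc_scaleE. Qed.

End Module.

(* The local ring R_p. *)
Definition local_ring : Type := loc R^o.
HB.instance Definition _ := GRing.Zmodule.on local_ring.

Let local_eq (a b : R) (s t : denom) :
  den t * a = den s * b -> @frac R^o a s = @frac R^o b t.
Proof. by move=> h; apply/frac_eqP; exists denom1; congr (_ * _). Qed.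

Definition local_one : local_ring := @frac R^o 1 denom1.
Definition local_mul (x y : local_ring) : local_ring :=
  @frac R^o ((repr x).1 * (repr y).1) (denomM (repr x).2 (repr y).2).

Lemma local_mulE (a b : R) (s t : denom) :
  local_mul (@frac R^o a s) (@frac R^o b t) = @frac R^o (a * b) (denomM s t).
Proof.
set x := repr (@frac R^o a s); set y := repr (@frac R^o b t).
have : @frac R^o x.1 x.2 = @frac R^o a s by rewrite /frac -surjective_pairing; exact: reprK.
have : @frac R^o y.1 y.2 = @frac R^o b t by rewrite /frac -surjective_pairing; exact: reprK.
move=> /frac_eqP[v k] /frac_eqP[u h]; apply/frac_eqP; exists (denomM u v).
rewrite /GRing.scale /= in h k *.
transitivity ((den u * (den s * x.1)) * (den v * (den t * y.1))); first by ring.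
by rewrite h k; ring.
Qed.

Let local_mulA : associative local_mul.
Proof.
elim/fracW=> a s; elim/fracW=> b t; elim/fracW=> c u; rewrite !local_mulE.
by apply: local_eq; rewrite /=; ring.
Qed.

Let local_mulC : commutative local_mul.
Proof.
elim/fracW=> a s; elim/fracW=> b t; rewrite !local_mulE.
by apply: local_eq; rewrite /=; ring.
Qed.

Let local_mul1 : left_id local_one local_mul.
Proof.
elim/fracW=> a s; rewrite local_mulE.
by apply: local_eq; rewrite /=; ring.
Qed.

Let local_mulDl : left_distributive local_mul +%R.
Proof.
elim/fracW=> a s; elim/fracW=> b t; elim/fracW=> c u.
rewrite fracD !local_mulE [RHS]fracD.
by apply: local_eq; rewrite /GRing.scale /=; ring.
Qed.

Let local_one_neq0 : local_one != 0.
Proof.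
apply/eqP => /frac_eqP[u]; rewrite scaler0 scaler0 /GRing.scale /= !mulr1 => u0.
have := den_notin u; rewrite u0 => /negP; apply.
by case: (spec_ideal p).
Qed.

HB.instance Definition _ := GRing.Zmodule_isComNzRing.Build local_ring
  local_mulA local_mulC local_mul1 local_mulDl local_one_neq0.

End Localization.

Section QuasiCoherent.
Variables (R : comNzRingType) (M : lmodType R).

Definition is_frac (p : spec R) (m : M) (f : R) (z : loc p M) : Prop :=
  exists fp : f \notin in_prime p, z = frac m (Denom fp).

Definition locally_frac (U : opens R) (s : forall x : U, loc (val x) M) : Prop :=
  forall x : U, exists (V : opens R) (m : M) (f : R),
    [/\ V `<=` U, oset V (val x) & forall y : U, oset V (val y) -> is_frac m f (s y)].

(* The sections over U of the sheaf associated with M: families of elements of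
   the stalks M_x, x in U, that are locally given by a fraction. *)
Record sections (U : opens R) : Type := Sections {
  germ :> forall x : U, loc (val x) M;
  germ_locally_frac : locally_frac germ }.

Lemma is_frac1 (p : spec R) (m : M) : is_frac m 1 (frac m (denom1 p)).
Proof. by exists (prime_notin1 p). Qed.

Lemma is_fracN (p : spec R) m f (z : loc p M) : is_frac m f z -> is_frac (- m) f (- z).
Proof. by move=> [fp ->]; exists fp; exact: loc_oppE. Qed.

Lemma is_fracZ a (p : spec R) m f (z : loc p M) :
  is_frac m f z -> is_frac (a *: m) f (a *: z).
Proof. by move=> [fp ->]; exists fp; exact: fracZ. Qed.

Lemma is_fracD (p : spec R) m n f g (z w : loc p M) :
  is_frac m f z -> is_frac n g w -> is_frac (g *: m + f *: n) (f * g) (z + w).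
Proof. by move=> [fp ->] [gp ->]; exists (prime_notinM fp gp); exact: fracD. Qed.

Section Module.
Variable U : opens R.
HB.instance Definition _ := gen_eqMixin (sections U).
HB.instance Definition _ := gen_choiceMixin (sections U).

Lemma sectionsP (s t : sections U) : (forall x, s x = t x) -> s = t.
Proof.
case: s t => [s sP] [t tP] /= h; have e : s = t by apply: functional_extensionality_dep.
by subst t; congr Sections; exact: Prop_irrelevance.
Qed.

Lemma global_frac (m : M) : locally_frac (fun x : U => frac m (denom1 (val x))).
Proof.
move=> x; exists U, m, 1; split=> // [|y _]; first exact: set_mem (valP x).
exact: is_frac1.
Qed.

Let oppP (s : sections U) : locally_frac (fun x => - s x).
Proof.
move=> x; have [V [m [f [VU Vx h]]]] := germ_locally_frac s x.
by exists V, (- m), f; split=> // y /h; exact: is_fracN.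
Qed.

Let scaleP a (s : sections U) : locally_frac (fun x => a *: s x).
Proof.
move=> x; have [V [m [f [VU Vx h]]]] := germ_locally_frac s x.
by exists V, (a *: m), f; split=> // y /h; exact: is_fracZ.
Qed.

Let addP (s t : sections U) : locally_frac (fun x => s x + t x).
Proof.
move=> x; have [V [m [f [VU Vx h]]]] := germ_locally_frac s x.
have [W [n [g [WU Wx k]]]] := germ_locally_frac t x.
exists (opens_cap V W), (g *: m + f *: n), (f * g); split=> //.
- by move=> y [/VU].
- by move=> y [/h hy /k ky]; exact: is_fracD.
Qed.

(* The element m/1; with m = 0 it is the zero section. *)
Definition section_of (m : M) : sections U := Sections (global_frac m).
Definition section_opp (s : sections U) : sections U := Sections (oppP s).
Definition section_add (s t : sections U) : sections U := Sections (addP s t).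
Definition section_scale (a : R) (s : sections U) : sections U := Sections (scaleP a s).

Let addA : associative section_add.
Proof. by move=> s t u; apply: sectionsP => x; exact: addrA. Qed.
Let addC : commutative section_add.
Proof. by move=> s t; apply: sectionsP => x; exact: addrC. Qed.
Let add0 : left_id (section_of 0) section_add.
Proof. by move=> s; apply: sectionsP => x; exact: add0r. Qed.
Let addN : left_inverse (section_of 0) section_opp section_add.
Proof. by move=> s; apply: sectionsP => x; exact: addNr. Qed.

HB.instance Definition _ := GRing.isZmodule.Build (sections U) addA addC add0 addN.

Let scaleA a b s : section_scale a (section_scale b s) = section_scale (a * b) s.
Proof. by apply: sectionsP => x; exact: scalerA. Qed.
Let scale1 : left_id 1 section_scale.
Proof. by move=> s; apply: sectionsP => x; exact: scale1r. Qed.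
Let scaleDr : right_distributive section_scale +%R.
Proof. by move=> a s t; apply: sectionsP => x; exact: scalerDr. Qed.
Let scaleDl s : {morph section_scale^~ s : a b / a + b}.
Proof. by move=> a b; apply: sectionsP => x; exact: scalerDl. Qed.

HB.instance Definition _ :=
  GRing.Zmodule_isLmodule.Build R (sections U) scaleA scale1 scaleDr scaleDl.
End Module.

Lemma germ_irr (U : opens R) (s : sections U) (x : spec R) (h k : x \in oset U) :
  s (exist _ x h) = s (exist _ x k).
Proof. by rewrite (bool_irrelevance h k). Qed.

Section Restriction.
Variables (U V : opens R) (VU : V `<=` U).

Definition incl (x : V) : U := exist _ (val x) (mem_set (VU (set_mem (valP x)))).

Lemma section_res_subproof (s : sections U) : locally_frac (fun x : V => s (incl x)).
Proof.
move=> x; have [W [m [f [WU Wx h]]]] := germ_locally_frac s (incl x).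
exists (opens_cap W V), m, f; split=> //.
- by move=> y [].
- by split=> //; exact: set_mem (valP x).
- by move=> y [Wy _]; exact: (h (incl y)).
Qed.

Definition section_res (s : sections U) : sections V :=
  Sections (section_res_subproof s).

Let section_res_linear : linear section_res.
Proof. by move=> a s t; apply: sectionsP. Qed.

HB.instance Definition _ :=
  GRing.isLinear.Build R (sections U) (sections V) *:%R section_res
    section_res_linear.
End Restriction.
End QuasiCoherent.

Section Presheaves.
Variable R : comNzRingType.

Record presheaf : Type := Presheaf {
  psec :> opens R -> lmodType R;
  pres : forall U V : opens R, V `<=` U -> {linear psec U -> psec V};
  pres_id : forall (U : opens R) (UU : U `<=` U) (s : psec U), pres UU s = s;
  pres_comp : forall (U V W : opens R) (VU : V `<=` U) (WV : W `<=` V)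
                     (WU : W `<=` U) (s : psec U),
    pres WU s = pres WV (pres VU s) }.

Record presheaf_hom (F G : presheaf) : Type := PresheafHom {
  hom_at :> forall U : opens R, {linear F U -> G U};
  hom_res : forall (U V : opens R) (VU : V `<=` U) (s : F U),
    hom_at V (pres F VU s) = pres G VU (hom_at U s) }.

(* For U open, the local ring of the open subscheme U at x is R_x. *)
Definition codim_le1 (U : opens R) : set (spec R) :=
  [set x | oset U x /\ krull_dim_le (local_ring x) 1].

Definition div_cover (U : opens R) (I : Type) (V : I -> opens R) : Prop :=
  codim_le1 U `<=` \bigcup_i V i.

Definition div_sheaf (F : presheaf) : Prop :=
  forall (U : opens R) (I : Type) (V : I -> opens R) (VU : forall i, V i `<=` U),
    div_cover U V ->
    forall s : (forall i, F (V i)),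
      (forall i j, pres F (@subIsetl _ (V i) (V j) : opens_cap (V i) (V j) `<=` V i) (s i)
                 = pres F (@subIsetr _ (V i) (V j) : opens_cap (V i) (V j) `<=` V j) (s j)) ->
      exists! t : F U, forall i, pres F (VU i) t = s i.

(* [eta] is universal among maps from [F] to sheaves of R-modules for the
   divisorial topology. *)
Definition div_sheafification (F G : presheaf) (eta : presheaf_hom F G) : Prop :=
  div_sheaf G /\
  forall (H : presheaf) (phi : presheaf_hom F H), div_sheaf H ->
    (exists psi : presheaf_hom G H, forall U s, psi U (eta U s) = phi U s) /\
    (forall psi psi' : presheaf_hom G H,
       (forall U s, psi U (eta U s) = phi U s) ->
       (forall U s, psi' U (eta U s) = phi U s) ->
       forall U s, psi U s = psi' U s).

Definition tilde (M : lmodType R) : presheaf.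
Proof.
refine (@Presheaf (fun U => sections M U)
  (fun U V VU => section_res (M := M) VU : {linear _ -> _}) _ _).
- move=> U UU s; apply: sectionsP => -[x xU]; by rewrite /incl /=; apply: (germ_irr s).
- by move=> U V W VU WV WU s; apply: sectionsP => -[x xW]; rewrite /incl /=; exact: (germ_irr s).
Defined.
End Presheaves.

Section Duals.
Variables (R : comNzRingType) (M : lmodType R).

Definition dual : Type := {linear M -> R^o}.
HB.instance Definition _ := gen_eqMixin dual.
HB.instance Definition _ := gen_choiceMixin dual.

Definition dual_fun (f : dual) : M -> R := (f : {linear M -> R^o}).

Lemma dualP (f g : dual) : dual_fun f =1 dual_fun g -> f = g.
Proof.
move=> /funext; rewrite /dual_fun; case: f g => [f cf] [g cg] /= e.
subst g; congr GRing.Linear.Pack; case: cf => [[a1] [a2]]; case: cg => [[b1] [b2]].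
by rewrite (Prop_irrelevance a1 b1) (Prop_irrelevance a2 b2).
Qed.

Definition dual0 : dual := \0 : {linear M -> R^o}.
Definition dual_opp (f : dual) : dual :=
  (\- (f : {linear M -> R^o})) : {linear M -> R^o}.
Definition dual_add (f g : dual) : dual :=
  ((f : {linear M -> R^o}) \+ (g : {linear M -> R^o})) : {linear M -> R^o}.
Definition dual_scale (a : R) (f : dual) : dual :=
  (a \*: (f : {linear M -> R^o})) : {linear M -> R^o}.

Let addA : associative dual_add.
Proof. by move=> f g h; apply: dualP => x; exact: addrA. Qed.
Let addC : commutative dual_add.
Proof. by move=> f g; apply: dualP => x; exact: addrC. Qed.
Let add0 : left_id dual0 dual_add.
Proof. by move=> f; apply: dualP => x; exact: add0r. Qed.
Let addN : left_inverse dual0 dual_opp dual_add.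
Proof. by move=> f; apply: dualP => x; exact: addNr. Qed.

HB.instance Definition _ := GRing.isZmodule.Build dual addA addC add0 addN.

Let scaleA a b f : dual_scale a (dual_scale b f) = dual_scale (a * b) f.
Proof. by apply: dualP => x; exact: mulrA. Qed.
Let scale1 : left_id 1 dual_scale.
Proof. by move=> f; apply: dualP => x; exact: mul1r. Qed.
Let scaleDr : right_distributive dual_scale +%R.
Proof. by move=> a f g; apply: dualP => x; exact: mulrDr. Qed.
Let scaleDl f : {morph dual_scale^~ f : a b / a + b}.
Proof. by move=> a b; apply: dualP => x; exact: mulrDl. Qed.

HB.instance Definition _ :=
  GRing.Zmodule_isLmodule.Build R dual scaleA scale1 scaleDr scaleDl.

End Duals.

Section Biduals.
Variables (R : comNzRingType) (M : lmodType R).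

Definition bidual : lmodType R := dual (dual M).

Definition eval (m : M) (f : dual M) : R^o := dual_fun f m.

Let eval_linear (m : M) : linear (eval m).
Proof. by []. Qed.
HB.instance Definition _ (m : M) :=
  GRing.isLinear.Build R (dual M) R^o *:%R (eval m) (eval_linear m).

Definition to_bidual (m : M) : bidual := (eval m : {linear dual M -> R^o}).
End Biduals.

(* Main.v *)
(* The divisorial sheafification of [tilde M] is the sheaf of families of stalks
   at the points of codimension at most one that are locally given by a fraction.
   A global section [s] of it and a form [phi] on [M] give an element [phi s] of
   the fraction field lying in every [R_p] with [dim R_p <= 1], hence in [R] since
   [R] is normal and noetherian; this defines the map to the bidual.  Conversely
   [R_p] is then a field or a discrete valuation ring, so [M_p] is free, and a dual
   basis of [M_p] represents an element of the bidual by a fraction near [p]. *)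

From HB Require Import structures.
Require Import Defs.
From mathcomp Require Import all_boot all_algebra.
From mathcomp Require Import ring_quotient all_classical topology ring.

Set Implicit Arguments.
Unset Strict Implicit.
Unset Printing Implicit Defensive.

Import GRing.Theory.
Local Open Scope ring_scope.
Local Open Scope classical_set_scope.

(* [fraction.frac] shadows the name. *)
Local Notation frac := Defs.frac.

(** The commutative algebra rests on one device, [dvd_of_stable_ideal]: a quotient that stabilises a
    nonzero ideal is integral, hence lies in [R]. Used on an associated prime of [R / b], on a
    smaller prime and on the elements divisible by all powers of [t / u], it makes the maximal ideal
    of [R_p] principal, bounds the dimension and bounds the exponents; it thus replaces Krull's
    principal ideal and intersection theorems. Elsewhere fractions are cross-multiplied:
    divisibility in [R_p] reads [s * a = b * w] with [s] outside [p], and equality of values of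
    forms is an identity in [R]. Germs at different points are compared at the generic point. Since
    sheafification is given only by its universal property, the explicit sheaf must be shown
    universal before the result carries over to every other sheafification. *)

Section Ideals.

(** * Annihilators in [R / b] and integrality *)

Variable R : idomainType.
Hypothesis noethR : noetherian R.

Definition is_ideal (I : set R) : Prop :=
  I 0 /\ forall a u v, I u -> I v -> I (a * u + v).

Lemma is_ideal_mul (I : set R) a u : is_ideal I -> I u -> I (a * u).
Proof. by move=> [I0 ID] Iu; rewrite -[_ * _]addr0; exact: ID. Qed.

Lemma is_ideal_add (I : set R) u v : is_ideal I -> I u -> I v -> I (u + v).
Proof. by move=> [I0 ID] Iu Iv; rewrite -[u]mul1r; exact: ID. Qed.

Lemma is_ideal_sum (I : set R) n (F : 'I_n -> R) :
  is_ideal I -> (forall i, I (F i)) -> I (\sum_i F i).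
Proof.
move=> iI IF; elim/big_ind: _ => // [|u v]; first by case: iI.
exact: is_ideal_add.
Qed.

(** Otherwise dependent choice builds a strictly increasing chain in [F]; the finitely many
    generators of its union all lie in one member, where the chain must stop. *)
Lemma noetherian_maximal (F : set (set R)) :
  F !=set0 -> (forall I, F I -> is_ideal I) ->
  exists2 I, F I & forall J, F J -> I `<=` J -> J `<=` I.
Proof.
move=> [I0 FI0] Fid; apply: contrapT => nmax.
have step (x : {I | F I}) : {y : {I | F I} | sval x `<` sval y}.
  case: x => I FI; apply: cid; apply: contrapT => nJ; apply: nmax; exists I => // J FJ IJ.
  by apply: contrapT => nJI; apply: nJ; exists (exist _ J FJ); split.
have [f [_ fS]] := dependent_choice step (exist _ I0 FI0).
pose S k := sval (f k).
have Sle m n : (m <= n)%N -> S m `<=` S n.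
  move=> /subnK <-; elim: (n - m)%N => // k IH; rewrite addSn.
  by apply: subset_trans IH _; case: (fS (k + m)%N).
have iS k : is_ideal (S k) by apply: Fid; exact: (svalP (f k)).
have [] := noethR (I := \bigcup_k S k).
- by exists 0%N => //; case: (iS 0%N).
- move=> a u v [m _ mu] [n _ nv]; exists (maxn m n) => //.
  by have [_] := iS (maxn m n); apply; [exact: Sle (leq_maxl m n) _ mu|exact: Sle (leq_maxr m n) _ nv].
move=> n [g hg].
have gS i : exists k, S k (g i).
  have [k _ h] : (\bigcup_k S k) (g i).
    rewrite hg; exists (fun j => (j == i)%:R); rewrite (bigD1 i) //= eqxx mul1r.
    by rewrite big1 ?addr0 // => j /negbTE ->; rewrite mul0r.
  by exists k.
have [k hk] := choice gS.
pose N := \max_i k i.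
have [_] := fS N; apply => x Sx; change (S N x).
have : (\bigcup_k S k) x by exists N.+1.
rewrite hg => -[c ->]; apply: (is_ideal_sum (iS N)) => i; apply: is_ideal_mul => //.
have kN : (k i <= N)%N by exact: leq_bigmax.
exact: Sle kN _ (hk i).
Qed.

(** The annihilator of the class of [a] in [R / b]. *)
Definition colon (b a : R) : set R := [set r | exists w, r * a = b * w].

Lemma is_ideal_colon b a : is_ideal (colon b a).
Proof.
split=> [|c u v [w hw] [z hz]]; first by exists 0; rewrite mul0r mulr0.
by exists (c * w + z); rewrite mulrDl mulrDr hz -mulrA hw; ring.
Qed.

Lemma colon_mulr b a c : colon b a `<=` colon b (a * c).
Proof. by move=> r [w hw]; exists (w * c); rewrite mulrA hw mulrA. Qed.

(* [S] is the complement of a prime, or [1]: the latter gives an associated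
   prime of [R / b], the former one contained in a given prime. *)
Lemma prime_colon (S : set R) (b a : R) :
  S 1 -> (forall s t, S s -> S t -> S (s * t)) ->
  (forall r, colon b a r -> ~ S r) ->
  exists c, (forall r, colon b (a * c) r -> ~ S r) /\
    forall r s, colon b (a * c) (r * s) -> colon b (a * c) r \/ colon b (a * c) s.
Proof.
move=> S1 SM hS.
pose F := [set I | exists c, I = colon b (a * c) /\ forall r, I r -> ~ S r].
have [||_ [c [-> cS]] cmax] := @noetherian_maximal F.
- by exists (colon b a), 1; rewrite mulr1.
- by move=> I [c [-> _]]; exact: is_ideal_colon.
exists c; split=> // r s rs; apply: contrapT => /not_orP[nr ns].
(* [x] lies in the ideal [colon b (a * c * d)] but not in the maximal member of [F] below it, so
   this larger ideal is not in [F]: it meets [S]. *)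
have meets d x : colon b (a * c * d) x -> ~ colon b (a * c) x ->
    exists2 t, S t & colon b (a * c) (t * d).
  move=> dx nx; apply: contrapT => nt; apply: nx.
  apply: (cmax (colon b (a * (c * d)))).
  - exists (c * d); split=> // t [w hw] St; apply: nt; exists t => //.
    by exists w; rewrite -hw; ring.
  - by rewrite mulrA; exact: colon_mulr.
  - by rewrite mulrA.
have [t St tr] : exists2 t, S t & colon b (a * c) (t * r).
  by apply: (meets r s) => //; case: rs => w hw; exists w; rewrite -hw; ring.
have [t' St' tt] : exists2 t', S t' & colon b (a * c) (t' * t).
  by apply: (meets t r) => //; case: tr => w hw; exists w; rewrite -hw; ring.
by apply: cS tt _; exact: SM.
Qed.

Hypothesis normalR : normal_domain R.

(* [a / b] stabilises a nonzero finitely generated ideal, hence is integral. *)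
Lemma dvd_of_stable_ideal (I : set R) (a b r0 : R) :
  is_ideal I -> I r0 -> r0 != 0 -> b != 0 ->
  (forall r, I r -> exists2 w, I w & a * r = b * w) ->
  exists c, a = b * c.
Proof.
move=> [I0 ID] Ir0 r0N0 bN0 stab.
have [n [g Ig]] := noethR I0 ID.
have gI i : I (g i).
  rewrite Ig; exists (fun j => (j == i)%:R); rewrite (bigD1 i) //= eqxx mul1r.
  by rewrite big1 ?addr0 // => j /negbTE ->; rewrite mul0r.
have /choice[c hc] i : exists c : 'I_n -> R, a * g i = b * \sum_j c j * g j.
  by have [w] := stab _ (gI i); rewrite Ig => -[c ->]; exists c.
pose C := \matrix_(j, i) c i j.
pose fr := @tofrac R.
have bfN0 : fr b != 0 by rewrite tofrac_eq0.
pose z := fr a / fr b.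
have [x zx] : exists x, z = fr x.
  (* The row of generators is an eigenvector of [C] for [z]; it is nonzero because [r0] is a
     combination of its entries. *)
  apply: normalR; exists (char_poly C); first exact: char_poly_monic.
  rewrite (map_char_poly fr) -eigenvalue_root_char; apply/eigenvalueP.
  exists (\row_j fr (g j)).
    apply/rowP => i; rewrite !mxE; apply: (mulfI bfN0).
    rewrite mulrA /z mulrCA divff // mulr1 -[RHS]rmorphM hc rmorphM; congr (_ * _).
    by rewrite rmorph_sum; apply: eq_bigr => j _; rewrite !mxE mulrC rmorphM.
  apply: contra r0N0 => /eqP /rowP g0.
  move: Ir0; rewrite Ig => -[d ->]; rewrite big1 // => i _.
  have := g0 i; rewrite !mxE => /eqP; rewrite tofrac_eq0 => /eqP ->.
  by rewrite mulr0.
exists x; apply/eqP; rewrite -tofrac_eq; apply/eqP.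
by rewrite tofracM -/fr -zx /z mulrCA divff // mulr1.
Qed.

(* The maximal ideal of the localization at an associated prime of [R / b] is
   generated by [t]. *)
Lemma prime_colon_principal (p : spec R) (a b : R) :
  b != 0 -> (forall r, (r \in in_prime p) <-> colon b a r) ->
  exists t u, [/\ t \in in_prime p, u \notin in_prime p &
    forall r, r \in in_prime p -> exists w, u * r = t * w].
Proof.
move=> bN0 pE.
have [t [u [tp up tu]]] :
    exists t u, [/\ t \in in_prime p, u \notin in_prime p & a * t = b * u].
  (* Otherwise [a / b] maps the prime into itself, so it lies in [R] and the annihilator contains
     1. *)
  apply: contrapT => nt.
  have [c ac] : exists c, a = b * c.
    apply: (@dvd_of_stable_ideal (colon b a) a b b) => //.
    - exact: is_ideal_colon.
    - by exists a.
    - move=> r [w hw]; exists w; last by rewrite mulrC.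
      apply/pE; apply/negPn/negP => wp; apply: nt; exists r, w; split=> //.
        by apply/pE; exists w.
      by rewrite mulrC.
  by have := prime_notin1 p; move=> /negP; apply; apply/pE; exists c; rewrite mul1r.
(* Here [u / t = a / b], so [u * r = t * w] with [w = (a / b) * r]. *)
exists t, u; split=> // r /pE[w hw]; exists w.
apply: (mulfI bN0); rewrite mulrA -tu mulrAC [a * r]mulrC hw; ring.
Qed.

End Ideals.

Lemma spec_mul (R : comNzRingType) (p : spec R) a u :
  u \in in_prime p -> a * u \in in_prime p.
Proof. by have [p0 _ pD] := spec_ideal p; move=> up; rewrite -[_ * _]addr0; exact: pD. Qed.

(** * Primes of [R_p] as primes of [R] inside [p] *)

Section LocalPrimes.
Variables (R : comNzRingType) (p : spec R).

Definition local_frac (r : R) (s : denom p) : local_ring p := @frac R p R^o r s.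

Lemma local_frac_eqP (a b : R) (s t : denom p) :
  local_frac a s = local_frac b t <->
  exists u : denom p, den u * (den t * a) = den u * (den s * b).
Proof. exact: (@frac_eqP R p R^o). Qed.

Lemma local_fracW (P : local_ring p -> Prop) :
  (forall r s, P (local_frac r s)) -> forall x, P x.
Proof. exact: (@fracW R p R^o). Qed.

Lemma local_fracM a b s t :
  local_frac a s * local_frac b t = local_frac (a * b) (denomM s t).
Proof. exact: local_mulE. Qed.

Lemma local_fracD a b s t :
  local_frac a s + local_frac b t = local_frac (den t * a + den s * b) (denomM s t).
Proof. exact: (@fracD R p R^o). Qed.

Lemma local_frac0 s : local_frac 0 s = 0.
Proof. by apply/local_frac_eqP; exists (denom1 p); rewrite !mulr0. Qed.

Definition spec_lt (q q' : spec R) : Prop :=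
  {subset in_prime q <= in_prime q'} /\ ~ {subset in_prime q' <= in_prime q}.

Section Contract.
Variable Q : spec (local_ring p).

Definition contract_pred : R -> bool :=
  fun r => local_frac r (denom1 p) \in in_prime Q.

Lemma contract_ideal : idealr_closed contract_pred.
Proof.
have [Q0 Q1 QD] := spec_ideal Q; split; rewrite ?unfold_in /contract_pred.
- by rewrite local_frac0.
- exact: Q1.
move=> a u v uQ vQ; rewrite unfold_in.
suff -> : local_frac (a * u + v) (denom1 p) =
    local_frac a (denom1 p) * local_frac u (denom1 p) + local_frac v (denom1 p).
  exact: QD.
rewrite local_fracM local_fracD; apply/local_frac_eqP; exists (denom1 p) => /=.
by ring.
Qed.

Lemma contract_prime : prime_idealr_closed contract_pred.
Proof.
move=> u v; rewrite !unfold_in => uv; apply: (spec_prime (s := Q)).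
rewrite local_fracM; suff -> : denomM (denom1 p) (denom1 p) = denom1 p by [].
by apply: val_inj; rewrite /= mulr1.
Qed.

Definition contract : spec R := Spec contract_ideal contract_prime.

(** [den s] is a unit of the local ring, so denominators do not affect membership in [Q]. *)
Lemma contractE r s : (local_frac r s \in in_prime Q) = (r \in in_prime contract).
Proof.
have e1 : local_frac (den s) (denom1 p) * local_frac r s = local_frac r (denom1 p).
  by rewrite local_fracM; apply/local_frac_eqP; exists (denom1 p) => /=; ring.
have e2 : local_frac 1 s * local_frac r (denom1 p) = local_frac r s.
  by rewrite local_fracM; apply/local_frac_eqP; exists (denom1 p) => /=; ring.
by rewrite [RHS]unfold_in /= /contract_pred; apply/idP/idP => h; [rewrite -e1 | rewrite -e2]; exact: spec_mul.
Qed.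
End Contract.

Section Extend.
Variable q : spec R.
Hypothesis qp : {subset in_prime q <= in_prime p}.

Definition extend_pred : local_ring p -> bool :=
  fun x => `[< exists2 r, r \in in_prime q & exists s, x = local_frac r s >].

(** Denominators avoid [p], hence [q], so any representative of the fraction decides membership. *)
Lemma extendE r s : (local_frac r s \in extend_pred) = (r \in in_prime q).
Proof.
have den_notin_q (t : denom p) : den t \notin in_prime q.
  by apply: contra (den_notin t); exact: qp.
rewrite [LHS]unfold_in /extend_pred; apply/asboolP/idP => [[a aq [t]]|rq].
  move=> /local_frac_eqP[u h].
  have : den u * (den t * r) \in in_prime q by rewrite h; do 2 apply: spec_mul.
  by apply: contraLR => rq; rewrite !prime_notin_mul rq !den_notin_q.
by exists r => //; exists s.
Qed.

Lemma extend_ideal : idealr_closed extend_pred.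
Proof.
have [q0 q1 qD] := spec_ideal q; split.
- by rewrite -(local_frac0 (denom1 p)) extendE.
- by rewrite -[1]/(local_frac 1 (denom1 p)) extendE.
elim/local_fracW=> a s; elim/local_fracW=> u t; elim/local_fracW=> v w.
rewrite (extendE u t) (extendE v w) => uq vq.
have -> : local_frac a s * local_frac u t + local_frac v w =
    local_frac (den w * a * u + den s * den t * v) (denomM (denomM s t) w).
  by rewrite local_fracM local_fracD mulrA.
rewrite extendE; apply: qD => //.
exact: spec_mul.
Qed.

Lemma extend_prime : prime_idealr_closed extend_pred.
Proof.
elim/local_fracW=> u t; elim/local_fracW=> v w.
by rewrite local_fracM !extendE => /spec_prime.
Qed.

Definition extend : spec (local_ring p) := Spec extend_ideal extend_prime.

End Extend.

(** An element outside [p] becomes a unit, which no prime contains. *)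
Lemma contract_sub (Q : spec (local_ring p)) :
  {subset in_prime (contract Q) <= in_prime p}.
Proof.
move=> r; rewrite -(contractE Q r (denom1 p)); apply: contraLR => rp.
have [_ Q1 _] := spec_ideal Q; apply: contra Q1 => rQ.
suff -> : 1 = local_frac 1 (Denom rp) * local_frac r (denom1 p) by exact: spec_mul.
rewrite local_fracM -[1]/(local_frac 1 (denom1 p)); apply/local_frac_eqP.
by exists (denom1 p) => /=; ring.
Qed.

(** Moves the dimension condition from the local ring to [R], where all later arguments on primes
    take place. *)
Lemma dim_le1P : krull_dim_le (local_ring p) 1 <->
  ~ exists q0 q1 q2, [/\ spec_lt q0 q1, spec_lt q1 q2 &
                         {subset in_prime q2 <= in_prime p}].
Proof.
split=> h.
  move=> [q0 [q1 [q2 [[q01 nq01] [q12 nq12] q2p]]]]; apply: h.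
  have q1p : {subset in_prime q1 <= in_prime p} by move=> r /q12/q2p.
  have q0p : {subset in_prime q0 <= in_prime p} by move=> r /q01/q1p.
  (* Only the terms 0, 1 and 2 matter; the sequence is constant from 2 on. *)
  exists (fun i => if i is i'.+1 then if i' is _.+1 then extend q2p else extend q1p
                   else extend q0p).
  have lt q q' (qp : {subset in_prime q <= in_prime p})
      (qp' : {subset in_prime q' <= in_prime p}) : spec_lt q q' ->
      {subset in_prime (extend qp) <= in_prime (extend qp')} /\
      ~ {subset in_prime (extend qp') <= in_prime (extend qp)}.
    move=> [qq nqq]; split.
      by elim/local_fracW=> r s /=; rewrite !extendE //; exact: qq.
    move=> e; apply: nqq => r rq.
    by have := e (local_frac r (denom1 p)); rewrite /= !extendE //; apply.
  by case=> [|[|//]] _; exact: lt.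
move=> [c hc]; apply: h; exists (contract (c 0%N)), (contract (c 1%N)), (contract (c 2%N)).
have lt i : (i <= 1)%N -> spec_lt (contract (c i)) (contract (c i.+1)).
  move=> /hc[ci nci]; split=> [r|e].
    by rewrite -!(contractE _ r (denom1 p)); exact: ci.
  by apply: nci; elim/local_fracW=> r s; rewrite !contractE; exact: e.
by split; [exact: lt | exact: lt | exact: contract_sub].
Qed.

End LocalPrimes.

(** * Primes of codimension at most one in a noetherian normal domain *)

Section Codim1.
Variable R : idomainType.
Hypotheses (noethR : noetherian R) (normalR : normal_domain R).

Lemma spec_is_ideal (p : spec R) : is_ideal [set r | r \in in_prime p].
Proof. by have [p0 _ pD] := spec_ideal p; split=> // a u v; exact: pD. Qed.

Definition zero_pred : R -> bool := pred1 0.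

Lemma zero_ideal : idealr_closed zero_pred.
Proof.
split; rewrite ?unfold_in /= ?eqxx ?oner_eq0 // => a u v.
by rewrite !unfold_in /= => /eqP-> /eqP->; rewrite mulr0 addr0.
Qed.

Lemma zero_prime : prime_idealr_closed zero_pred.
Proof. by move=> u v; rewrite !unfold_in /= mulf_eq0. Qed.

Definition generic_point : spec R := Spec zero_ideal zero_prime.

Lemma in_generic r : (r \in in_prime generic_point) = (r == 0).
Proof. by []. Qed.

Lemma generic_dim_le1 : krull_dim_le (local_ring generic_point) 1.
Proof.
apply/dim_le1P => -[q0 [q1 [q2 [[_ nq] [q12 _] q2p]]]]; apply: nq => r /q12/q2p.
by rewrite in_generic => /eqP ->; case: (spec_ideal q0).
Qed.

Lemma spec_of_colon (b a : R) :
  ~ colon b a 1 ->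
  (forall r s, colon b a (r * s) -> colon b a r \/ colon b a s) ->
  exists p : spec R, forall r, (r \in in_prime p) <-> colon b a r.
Proof.
move=> n1 pr; pose P : R -> bool := fun r => `[< colon b a r >].
have [c0 cD] := is_ideal_colon b a.
have iP : idealr_closed P.
  split=> [||c u v]; rewrite ?unfold_in; [exact/asboolP|exact/asboolP|].
  by move=> /asboolP uP /asboolP vP; apply/asboolP; exact: cD.
have pP : prime_idealr_closed P.
  by move=> u v /asboolP /pr[h|h]; apply/orP; [left|right]; apply/asboolP.
by exists (Spec iP pP) => r; split=> [/asboolP //|h]; apply/asboolP.
Qed.

(** In a chain [q0 < q1 < q2] inside [p], the nonzero prime [q1] cannot contain [t], a local
    generator of [p]. Hence [u / t] stabilises [q1], so [t] divides [u] and [u] lies in [p]. *)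
Lemma dim_le1_of_principal (p : spec R) (t u : R) :
  t \in in_prime p -> u \notin in_prime p -> t != 0 ->
  (forall r, r \in in_prime p -> exists w, u * r = t * w) ->
  krull_dim_le (local_ring p) 1.
Proof.
move=> tp up t0 ut; apply/dim_le1P => -[q0 [q1 [q2 [[_ nq01] [q12 nq12] q2p]]]].
have uq1 : u \notin in_prime q1 by apply: contra up => /q12/q2p.
have tq1 : t \notin in_prime q1.
  apply/negP => tq1; apply: nq12 => r /q2p/ut[w uw].
  have : u * r \in in_prime q1 by rewrite uw mulrC; exact: spec_mul.
  by move=> /spec_prime; rewrite (negbTE uq1).
have [r rq1 r0] : exists2 r, r \in in_prime q1 & r != 0.
  apply: contrapT => h; apply: nq01 => r rq1; have [->|r0] := eqVneq r 0.
    by case: (spec_ideal q0).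
  by case: h; exists r.
have [c uc] : exists c, u = t * c.
  apply: (dvd_of_stable_ideal noethR normalR (spec_is_ideal q1) rq1 r0 t0) => x xq1.
  have [w uw] := ut _ (q2p _ (q12 _ xq1)); exists w => //.
  have : t * w \in in_prime q1 by rewrite -uw; exact: spec_mul.
  by move=> /spec_prime; rewrite (negbTE tq1).
by move: up; rewrite uc mulrC spec_mul.
Qed.

(** If [b] does not divide [a], some multiple of the class of [a] in [R / b] has a prime
    annihilator. That prime has codimension at most one, and the [s] provided outside it would
    annihilate this multiple. *)
Lemma dvd_of_codim1 (a b : R) : b != 0 ->
  (forall p : spec R, krull_dim_le (local_ring p) 1 ->
     exists2 s, s \notin in_prime p & exists w, s * a = b * w) ->
  exists c, a = b * c.
Proof.
move=> b0 loc_dvd; apply: contrapT => ndvd.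
have [||r [w rw] r1|c [c1 cpr]] := @prime_colon R noethR [set 1] b a.
- by [].
- by move=> s t -> ->; rewrite mulr1.
- by apply: ndvd; exists w; rewrite -rw r1 mul1r.
have [p pE] := spec_of_colon (fun h => c1 1 h erefl) cpr.
have [t [u [tp up tu]]] := prime_colon_principal noethR normalR b0 pE.
have bp : b \in in_prime p by apply/pE; exists (a * c).
have t0 : t != 0.
  have [w ub] := tu _ bp; apply/eqP => t0; move/eqP: ub.
  by rewrite t0 mul0r mulf_eq0 (negbTE b0) orbF => /eqP u0; move: up; rewrite u0 -t0 tp.
have [s sp [w sw]] := loc_dvd p (dim_le1_of_principal tp up t0 tu).
by move/negP: sp; apply; apply/pE; exists (w * c); rewrite mulrA sw mulrA.
Qed.

(** An annihilator in [R / b] that is maximal among those inside [p] is a prime containing [b],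
    hence nonzero; the dimension forces it to be [p], which is therefore an associated prime. *)
Lemma codim1_principal (p : spec R) (b : R) :
  krull_dim_le (local_ring p) 1 -> b \in in_prime p -> b != 0 ->
  exists t u, [/\ t \in in_prime p, u \notin in_prime p &
    forall r, r \in in_prime p -> exists w, u * r = t * w].
Proof.
move=> /dim_le1P dimp bp b0.
have [||r [w rw] /negP|c [cp cpr]] :=
    @prime_colon R noethR [set s | s \notin in_prime p] b 1.
- exact: prime_notin1.
- by move=> s t; exact: prime_notinM.
- by apply; rewrite -[r]mulr1 rw mulrC spec_mul.
have [q qE] := spec_of_colon (fun h => cp 1 h (prime_notin1 p)) cpr.
have qp : {subset in_prime q <= in_prime p}.
  by move=> r /qE/cp rp; apply/negPn/negP.
have pq : {subset in_prime p <= in_prime q}.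
  apply: contrapT => npq; apply: dimp; exists generic_point, q, p; split=> //.
  split=> [r|e]; first by rewrite in_generic => /eqP ->; case: (spec_ideal q).
  move: b0; rewrite -in_generic e //; apply/qE; exists (1 * c); ring.
apply: (@prime_colon_principal R noethR normalR p (1 * c) b) => // r.
by split=> [/pq/qE|/qE/qp].
Qed.

(** Division by [t / u] lowers the order by one; so [u / t] stabilises the infinitely divisible
    elements in [codim1_power]. *)
Lemma power_dvd (t u : R) (w r : R) k : t * w = u * r -> 
  (exists v, u ^+ k.+1 * r = t ^+ k.+1 * v) -> t != 0 -> exists v, u ^+ k * w = t ^+ k * v.
Proof.
move=> tw [v uv] t0; exists v; apply: (mulfI t0).
by rewrite mulrCA tw [LHS]mulrA -exprSr uv exprS -mulrA.
Qed.

(* [t / u] generates the maximal ideal of [R_p], so every nonzero element of [R]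
   is a power of it up to a unit of [R_p]. *)
Lemma codim1_power (p : spec R) (t u a : R) :
  t \in in_prime p -> u \notin in_prime p ->
  (forall r, r \in in_prime p -> exists w, u * r = t * w) -> t != 0 -> a != 0 ->
  exists k, exists2 w, w \notin in_prime p & u ^+ k * a = t ^+ k * w.
Proof.
move=> tp up ut t0 a0.
(* The elements divisible by every power of [t / u]; if [a] were one of them, [u / t] would
   stabilise a nonzero ideal and [t] would divide [u]. *)
pose I := [set r | forall k, exists w, u ^+ k * r = t ^+ k * w].
have Ip r : I r -> exists w, u * r = t * w by move=> /(_ 1%N); rewrite !expr1.
have [Ia|] := pselect (I a).
  have [c uc] : exists c, u = t * c.
    apply: (@dvd_of_stable_ideal R noethR normalR I u t a) => //.
    - split=> [k|c x y xI yI k]; first by exists 0; rewrite !mulr0.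
      have [[v xv] [w yw]] := (xI k, yI k); exists (c * v + w).
      by rewrite mulrDr yw mulrCA xv mulrDr mulrCA.
    - move=> r rI; have [w uw] := Ip r rI; exists w => // k.
      by apply: (@power_dvd t u w r) => //; exact: rI.
  by move: up; rewrite uc mulrC spec_mul.
move=> /existsNP[k nk].
elim: k nk => [|k IH] nk; first by case: nk; exists a; rewrite !expr0 !mul1r.
have [[w uw]|/IH //] := pselect (exists w, u ^+ k * a = t ^+ k * w).
(* Here the power [k] divides [a] and the next does not; a cofactor in [p] would supply one more
   factor [t / u]. *)
exists k, w => //; apply/negP => wp; apply: nk.
have [v uv] := ut _ wp; exists v.
by rewrite exprS -mulrA uw mulrCA uv exprSr mulrA.
Qed.

(** [R_p] is a valuation ring: both elements are units times powers of [t / u], and the smaller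
    exponent divides. *)
Lemma codim1_total_dvd (p : spec R) (a b : R) :
  krull_dim_le (local_ring p) 1 ->
  exists2 s, s \notin in_prime p &
    (exists w, s * a = b * w) \/ (exists w, s * b = a * w).
Proof.
move=> dimp.
have [->|a0] := eqVneq a 0.
  by exists 1; [exact: prime_notin1 | left; exists 0; rewrite !mulr0].
have [->|b0] := eqVneq b 0.
  by exists 1; [exact: prime_notin1 | right; exists 0; rewrite !mulr0].
have [ap|ap] := boolP (a \in in_prime p); last by exists a => //; right; exists b.
have [t [u [tp up ut]]] := codim1_principal dimp ap a0.
have t0 : t != 0.
  have [w ua] := ut _ ap; apply/eqP => t0; move/eqP: ua.
  by rewrite t0 mul0r mulf_eq0 (negbTE a0) orbF => /eqP u0; move: up; rewrite u0 -t0 tp.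
have [k [v vp va]] := codim1_power tp up ut t0 a0.
have [l [w wp wb]] := codim1_power tp up ut t0 b0.
have uX n : u ^+ n \notin in_prime p.
  by elim: n => [|n IH]; [exact: prime_notin1 | rewrite exprS; exact: prime_notinM].
(* The quotient [d / c] has denominator [x * u ^+ (n - m)]; the multiple [x * u ^+ n] of it is used
   to clear it. *)
have main m n x y (c d : R) : (m <= n)%N -> u ^+ m * c = t ^+ m * x ->
    u ^+ n * d = t ^+ n * y -> exists z, (x * u ^+ n) * d = c * z.
  move=> mn hc hd; exists (u ^+ m * t ^+ (n - m) * y).
  rewrite -mulrA hd -{1}(subnKC mn) exprD.
  transitivity (t ^+ m * x * (t ^+ (n - m) * y)); first by ring.
  rewrite -hc; ring.
have [kl|lk] := leqP k l.
  exists (v * u ^+ l); first exact: prime_notinM.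
  right; exact: main kl va wb.
exists (w * u ^+ k); first exact: prime_notinM.
left; exact: main (ltnW lk) wb va.
Qed.

End Codim1.

Lemma linear_of (R : pzRingType) (U V : lmodType R) (f : U -> V) :
  linear f -> exists g : {linear U -> V}, g =1 f.
Proof.
move=> lf; pose g : {linear U -> V} := HB.pack f (GRing.isLinear.Build R U V *:%R f lf).
by exists g.
Qed.

(** * Local freeness of [M] and dual bases *)

Section DualBasis.
Variables (R : idomainType) (M : lmodType R).
Hypotheses (noethR : noetherian R) (normalR : normal_domain R).
Hypotheses (finM : finite_module M) (tfM : torsion_free M).
Variable p : spec R.
Hypothesis dimp : krull_dim_le (local_ring p) 1.

(** An entry of minimal valuation, found by comparing each new entry with the previous minimum; the
    single [s] collects all denominators. *)
Lemma codim1_min_dvd (x : R) (l : seq R) :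
  exists2 y, y \in x :: l &
    exists2 s, s \notin in_prime p & {in x :: l, forall z, exists w, s * z = y * w}.
Proof.
elim: l => [|z l [y yl [s sp hs]]].
  exists x; rewrite ?mem_head //; exists 1; first exact: prime_notin1.
  by move=> z; rewrite inE => /eqP ->; exists 1; rewrite mulrC.
have subl v : (v \in [:: x, z & l]) = (v == z) || (v \in x :: l).
  by rewrite !inE orbCA.
have [t tp [[w tz]|[w ty]]] := codim1_total_dvd noethR normalR z y dimp.
  exists y; first by rewrite subl yl orbT.
  exists (s * t); first exact: prime_notinM.
  move=> v; rewrite subl => /orP[/eqP ->|/hs[c sv]].
    by exists (s * w); rewrite -mulrA tz mulrCA.
  by exists (t * c); rewrite mulrAC sv; ring.
exists z; first by rewrite subl eqxx.
exists (s * t); first exact: prime_notinM.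
move=> v; rewrite subl => /orP[/eqP ->|/hs[c sv]].
  by exists (s * t); rewrite mulrC.
by exists (w * c); rewrite mulrAC sv mulrA -ty; ring.
Qed.

Definition generated_at (n : nat) : Prop :=
  exists (g : 'I_n -> M) (s : R), s \notin in_prime p /\
    forall m, exists c : 'I_n -> R, s *: m = \sum_i c i *: g i.

(* With a minimal number of generators a relation is trivial: one of its
   coefficients would divide all the others in the valuation ring [R_p], making
   the corresponding generator superfluous. *)
Lemma codim1_free : exists n (g : 'I_n -> M) (s : R),
  [/\ s \notin in_prime p,
      forall m, exists c : 'I_n -> R, s *: m = \sum_i c i *: g i &
      forall a : 'I_n -> R, \sum_i a i *: g i = 0 -> forall i, a i = 0].
Proof.
have exg : exists n, `[< generated_at n >].
  have [n [g hg]] := finM; exists n; apply/asboolP; exists g, 1.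
  by split=> [|m]; [exact: prime_notin1 | rewrite scale1r].
have [n /asboolP[g [s [sp hg]]] nmin] := ex_minnP exg.
exists n, g, s; split=> // a ag0 i0; apply: contrapT => /eqP ai0.
case: n i0 g hg nmin a ag0 ai0 => [[]//|n] i0 g hg nmin a ag0 ai0.
(* A coefficient of minimal valuation; it is nonzero because it divides [a i0] locally. *)
have [y yl [t tp ht]] := codim1_min_dvd (a i0) (codom a).
have {yl}[j yj] : exists j, y = a j.
  by move: yl; rewrite inE => /orP[/eqP ->|/codomP[j ->]]; [exists i0|exists j].
have {ht}ht i : exists w, t * a i = a j * w.
  by rewrite -yj; apply: ht; rewrite inE codom_f orbT.
have t0 : t != 0 by apply: contraNneq tp => ->; case: (spec_ideal p).
have aj0 : a j != 0.
  have [w hw] := ht i0; apply: contraNneq ai0 => aj0; move/eqP: hw.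
  by rewrite aj0 mul0r mulf_eq0 (negbTE t0).
have [b hb] := choice ht.
have bj : b j = t by apply: (mulfI aj0); rewrite -hb mulrC.
(* Torsion-freeness permits dividing the relation by [a j]. The coefficient of [g j] is now [t],
   outside [p], so the other generators suffice once [s] is replaced by [t * s]. *)
have rel : \sum_i b i *: g i = 0.
  have /tfM[/eqP|//] : a j *: \sum_i b i *: g i = 0; last by rewrite (negbTE aj0).
  rewrite scaler_sumr (eq_bigr (fun i => t *: (a i *: g i))).
    by rewrite -scaler_sumr ag0 scaler0.
  by move=> i _; rewrite !scalerA hb.
suff /asboolP/nmin : generated_at n by rewrite ltnn.
exists (fun i => g (lift j i)), (t * s); split; first exact: prime_notinM.
move=> m; have [c hc] := hg m.
exists (fun i => t * c (lift j i) - c j * b (lift j i)).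
have lj (F : 'I_n.+1 -> M) : \sum_i F i = F j + \sum_i F (lift j i).
  by rewrite (bigD1_ord j).
rewrite -scalerA hc; move: rel; rewrite lj bj => /eqP; rewrite addr_eq0 => /eqP rel.
rewrite lj scalerDr scalerA mulrC -scalerA rel scalerN !scaler_sumr addrC -sumrB.
by apply: eq_bigr => i _; rewrite !scalerA scalerBl.
Qed.

(** Freeness makes the coefficients of [s *: m] unique, hence linear in [m]; as one [s] serves all
    [m], they are forms on [M] itself. *)
Lemma codim1_dual_basis :
  exists n (g : 'I_n -> M) (phi : 'I_n -> dual M) (s : R), s \notin in_prime p /\
    forall m, s *: m = \sum_i dual_fun (phi i) m *: g i.
Proof.
have [n [g [s [sp hg free]]]] := codim1_free.
have [c hc] := choice hg.
have lin i : linear (fun m => c m i : R^o).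
  move=> a x y; apply/eqP; rewrite -subr_eq0; apply/eqP.
  apply: (free (fun i => c (a *: x + y) i - (a * c x i + c y i))).
  rewrite (eq_bigr (fun i => c (a *: x + y) i *: g i -
     (a *: (c x i *: g i) + c y i *: g i))); last first.
    by move=> k _; rewrite scalerBl scalerDl scalerA.
  rewrite sumrB big_split -scaler_sumr /= -!hc scalerDr !scalerA.
  by rewrite [s * a]mulrC subrr.
have [phi hphi] := choice (fun i => linear_of (lin i)).
exists n, g, phi, s; split=> // m; rewrite hc; apply: eq_bigr => i _.
by rewrite -hphi.
Qed.

End DualBasis.

(** * The explicit divisorial sheaf and its universal property *)

Section DivSections.
Variables (R : comNzRingType) (M : lmodType R).

(** The fraction is required only at the points of [V] of codimension at most one; [f] may vanish at
    the others. *)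
Definition div_locally_frac (U : opens R)
    (s : forall x, codim_le1 U x -> loc x M) : Prop :=
  forall x, codim_le1 U x -> exists (V : opens R) (m : M) (f : R),
    [/\ V `<=` U, oset V x &
        forall y (Uy : codim_le1 U y), oset V y -> is_frac m f (s y Uy)].

Record div_sections (U : opens R) : Type := DivSections {
  div_germ :> forall x, codim_le1 U x -> loc x M;
  div_germ_locally_frac : div_locally_frac div_germ }.

Lemma codim_le1S (U V : opens R) : V `<=` U -> codim_le1 V `<=` codim_le1 U.
Proof. by move=> VU x [/VU]. Qed.

Section Module.
Variable U : opens R.
HB.instance Definition _ := gen_eqMixin (div_sections U).
HB.instance Definition _ := gen_choiceMixin (div_sections U).

Lemma div_sectionsP (s t : div_sections U) : (forall x Ux, s x Ux = t x Ux) -> s = t.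
Proof.
case: s t => [s sP] [t tP] /= h.
have e : s = t by apply: functional_extensionality_dep => x; exact: functional_extensionality_dep.
by subst t; congr DivSections; exact: Prop_irrelevance.
Qed.

Lemma section_div_subproof (s : sections M U) :
  div_locally_frac (fun x (Ux : codim_le1 U x) => s (exist _ x (mem_set Ux.1))).
Proof.
move=> x Ux; have [V [m [f [VU Vx h]]]] := germ_locally_frac s (exist _ x (mem_set Ux.1)).
by exists V, m, f; split=> // y Uy Vy; exact: h (exist _ y (mem_set Uy.1)) Vy.
Qed.

Definition section_div (s : sections M U) : div_sections U :=
  DivSections (section_div_subproof s).

Let oppP (s : div_sections U) : div_locally_frac (fun x Ux => - s x Ux).
Proof.
move=> x Ux; have [V [m [f [VU Vx h]]]] := div_germ_locally_frac s Ux.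
by exists V, (- m), f; split=> // y Uy Vy; exact/is_fracN/h.
Qed.

Let scaleP a (s : div_sections U) : div_locally_frac (fun x Ux => a *: s x Ux).
Proof.
move=> x Ux; have [V [m [f [VU Vx h]]]] := div_germ_locally_frac s Ux.
by exists V, (a *: m), f; split=> // y Uy Vy; exact/is_fracZ/h.
Qed.

Let addP (s t : div_sections U) : div_locally_frac (fun x Ux => s x Ux + t x Ux).
Proof.
move=> x Ux; have [V [m [f [VU Vx h]]]] := div_germ_locally_frac s Ux.
have [W [n [g [WU Wx k]]]] := div_germ_locally_frac t Ux.
exists (opens_cap V W), (g *: m + f *: n), (f * g); split=> //.
- by move=> y [/VU].
- by move=> y Uy [Vy Wy]; exact: is_fracD (h y Uy Vy) (k y Uy Wy).
Qed.

Let zero := section_div (section_of U (0 : M)).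
Let opp s := DivSections (oppP s).
Let add s t := DivSections (addP s t).
Let scale a s := DivSections (scaleP a s).

Let addA : associative add.
Proof. by move=> s t u; apply: div_sectionsP => x Ux; exact: addrA. Qed.
Let addC : commutative add.
Proof. by move=> s t; apply: div_sectionsP => x Ux; exact: addrC. Qed.
Let add0 : left_id zero add.
Proof. by move=> s; apply: div_sectionsP => x Ux; exact: add0r. Qed.
Let addN : left_inverse zero opp add.
Proof. by move=> s; apply: div_sectionsP => x Ux; exact: addNr. Qed.

HB.instance Definition _ := GRing.isZmodule.Build (div_sections U) addA addC add0 addN.

Let scaleA a b s : scale a (scale b s) = scale (a * b) s.
Proof. by apply: div_sectionsP => x Ux; exact: scalerA. Qed.
Let scale1 : left_id 1 scale.
Proof. by move=> s; apply: div_sectionsP => x Ux; exact: scale1r. Qed.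
Let scaleDr : right_distributive scale +%R.
Proof. by move=> a s t; apply: div_sectionsP => x Ux; exact: scalerDr. Qed.
Let scaleDl s : {morph scale^~ s : a b / a + b}.
Proof. by move=> a b; apply: div_sectionsP => x Ux; exact: scalerDl. Qed.

HB.instance Definition _ :=
  GRing.Zmodule_isLmodule.Build R (div_sections U) scaleA scale1 scaleDr scaleDl.

Let section_div_linear : linear section_div.
Proof. by move=> a s t; apply: div_sectionsP. Qed.

HB.instance Definition _ :=
  GRing.isLinear.Build R (sections M U) (div_sections U) *:%R section_div
    section_div_linear.
End Module.

Section Restriction.
Variables (U V : opens R) (VU : V `<=` U).

Lemma div_res_subproof (s : div_sections U) :
  div_locally_frac (fun x (Vx : codim_le1 V x) => s x (codim_le1S VU Vx)).
Proof.
move=> x Vx.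
have [W [m [f [WU Wx h]]]] := div_germ_locally_frac s (codim_le1S VU Vx).
exists (opens_cap W V), m, f; split=> //; first by move=> y [].
- by case: Vx.
- by move=> y Vy [Wy _]; exact: h.
Qed.

Definition div_res (s : div_sections U) : div_sections V :=
  DivSections (div_res_subproof s).

Let div_res_linear : linear div_res.
Proof. by move=> a s t; apply: div_sectionsP. Qed.

HB.instance Definition _ :=
  GRing.isLinear.Build R (div_sections U) (div_sections V) *:%R div_res
    div_res_linear.
End Restriction.

Lemma div_germ_irr (U : opens R) (s : div_sections U) x (h k : codim_le1 U x) :
  s x h = s x k.
Proof. by rewrite (Prop_irrelevance h k). Qed.

Definition div_tilde : presheaf R.
Proof.
refine (@Presheaf R (fun U => div_sections U) (fun U V VU => div_res VU : {linear _ -> _}) _ _).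
- by move=> U UU s; apply: div_sectionsP => x Ux /=; exact: div_germ_irr.
- by move=> U V W VU WV WU s; apply: div_sectionsP => x Wx /=; exact: div_germ_irr.
Defined.

Definition to_div_tilde : presheaf_hom (tilde M) div_tilde.
Proof.
refine (@PresheafHom R (tilde M) div_tilde (fun U => @section_div U : {linear _ -> _}) _).
by move=> U V VU s; apply: div_sectionsP => x Vx; exact: (germ_irr s).
Defined.

(** Every point that carries a germ is reached by every divisorial covering, so sections glue
    pointwise. *)
Lemma div_tilde_sheaf : div_sheaf div_tilde.
Proof.
move=> U I V VU cov s compat.
have compatx i j x (Vi : codim_le1 (V i) x) (Vj : codim_le1 (V j) x) :
    s i x Vi = s j x Vj.
  have Vx : codim_le1 (opens_cap (V i) (V j)) x by case: Vi Vj => ? ? [].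
  have /(congr1 (fun t : div_sections _ => t x Vx)) := compat i j.
  by rewrite /= (div_germ_irr _ _ Vi) (div_germ_irr _ _ Vj).
have ex x : codim_le1 U x -> {i | codim_le1 (V i) x}.
  move=> Ux; apply: cid; have [i _ Vx] := cov x Ux.
  by exists i; split=> //; case: Ux.
pose t x (Ux : codim_le1 U x) := s (sval (ex x Ux)) x (svalP (ex x Ux)).
have tE i x Ux Vx : t x Ux = s i x Vx by exact: compatx.
have tP : div_locally_frac t.
  move=> x Ux; have Vx := svalP (ex x Ux); move: (sval _) Vx => i Vx.
  have [W [m [f [WV Wx h]]]] := div_germ_locally_frac (s i) Vx.
  exists W, m, f; split=> //; first by move=> y /WV/VU.
  move=> y Uy Wy; have Vy : codim_le1 (V i) y by split; [exact: WV | case: Uy].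
  by rewrite (tE i y Uy Vy); exact: h.
exists (DivSections tP); split.
  by move=> i; apply: div_sectionsP => x Vx; exact: tE.
move=> t' ht'; apply: div_sectionsP => x Ux /=.
have Vx := svalP (ex x Ux); move: (sval _) Vx => i Vx.
rewrite (tE i x Ux Vx) -ht' /=; exact: div_germ_irr.
Qed.

Lemma open_nonvanishing (E : set R) : open (nonvanishing E).
Proof. by rewrite zariski_openE; exists E. Qed.

Definition principal_open (f : R) : opens R := Opens (open_nonvanishing [set f]).

Lemma principal_openP f x : oset (principal_open f) x <-> f \notin in_prime x.
Proof. by split=> [[_ ->]|fx]; [|exists f]. Qed.

Lemma frac_section (U : opens R) (m : M) (f : R) :
  (forall x, oset U x -> f \notin in_prime x) ->
  exists s : sections M U, forall x, is_frac m f (s x).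
Proof.
move=> fU; pose s (x : U) : loc (val x) M := frac m (Denom (fU _ (set_mem (valP x)))).
have sE x : is_frac m f (s x) by exists (fU _ (set_mem (valP x))).
have sP : locally_frac s.
  by move=> x; exists U, m, f; split=> //; exact: set_mem (valP x).
by exists (Sections sP).
Qed.

Lemma is_frac_inj (x : spec R) (m : M) f (z w : loc x M) :
  is_frac m f z -> is_frac m f w -> z = w.
Proof. by move=> [h ->] [k ->]; rewrite (Prop_irrelevance h k). Qed.

(** Shrinking to the locus where [f] does not vanish makes [m / f] a section of [tilde M]. *)
Lemma to_div_tilde_locally_surj (U : opens R) (s : div_sections U) x :
  codim_le1 U x -> exists (V : opens R) (VU : V `<=` U) (r : sections M V),
    oset V x /\ div_res VU s = section_div r.
Proof.
move=> Ux; have [V [m [f [VU Vx h]]]] := div_germ_locally_frac s Ux.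
pose W := opens_cap V (principal_open f).
have [r rE] : exists r : sections M W, forall y, is_frac m f (r y).
  by apply: frac_section => y [_ /principal_openP].
have WU : W `<=` U by move=> y [/VU].
exists W, WU, r; split.
  by split=> //; apply/principal_openP; have [] := h x Ux Vx.
apply: div_sectionsP => y Wy /=; apply: (@is_frac_inj y m f) (rE (exist _ y (mem_set Wy.1))); apply: h.
by case: Wy => -[].
Qed.

Section UniversalProperty.
Variables (H : presheaf R) (phi : presheaf_hom (tilde M) H).
Hypothesis shH : div_sheaf H.

(** One neighbourhood for each point of codimension at most one already makes a divisorial
    covering. *)
Lemma div_sheaf_separated (U : opens R) (t t' : H U) :
  (forall x, codim_le1 U x -> exists (V : opens R) (VU : V `<=` U),
     oset V x /\ pres H VU t = pres H VU t') -> t = t'.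
Proof.
move=> tt'; pose I := {x | codim_le1 U x}.
have V_ (i : I) : {V : opens R & {VU : V `<=` U | oset V (sval i) /\ pres H VU t = pres H VU t'}}.
  case: i => x Ux /=; have [V hV] := cid (tt' x Ux).
  by exists V; have [VU h] := cid hV; exists VU.
pose V i := projT1 (V_ i); pose VU i : V i `<=` U := sval (projT2 (V_ i)).
have [Vx e] : (forall i, oset (V i) (sval i)) /\ forall i, pres H (VU i) t = pres H (VU i) t'.
  by split=> i; have [] := svalP (projT2 (V_ i)).
have cov : div_cover U V by move=> x Ux; exists (exist _ x Ux) => //; exact: Vx (exist _ x Ux).
have [] := shH VU cov (s := fun i => pres H (VU i) t).
  move=> i j; have WU : opens_cap (V i) (V j) `<=` U by move=> y [/VU].
  by rewrite -!(pres_comp _ _ WU).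
move=> u [_ uniq]; rewrite -(uniq t) //; apply: uniq => i; by rewrite e.
Qed.

(** An equality of fractions at [x] is witnessed by some [u] outside [x] and persists where [u] does
    not vanish, so the two sections agree near each point of codimension at most one. *)
Lemma hom_factors_div (U : opens R) (r r' : sections M U) :
  section_div r = section_div r' -> phi U r = phi U r'.
Proof.
move=> rr'; apply: div_sheaf_separated => x Ux.
have [V [m [f [VU Vx h]]]] := germ_locally_frac r (exist _ x (mem_set Ux.1)).
have [V' [m' [f' [VU' Vx' h']]]] := germ_locally_frac r' (exist _ x (mem_set Ux.1)).
have /= [fx rx] := h (exist _ x (mem_set Ux.1)) Vx.
have /= [fx' rx'] := h' (exist _ x (mem_set Ux.1)) Vx'.
have := congr1 (fun t : div_sections U => t x Ux) rr'.
rewrite /= rx rx' => /frac_eqP[u /= hu].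
pose W := opens_cap (opens_cap V V') (principal_open (den u)).
have WU : W `<=` U by move=> y [[/VU]].
exists W, WU; split.
  by split=> //; apply/principal_openP; exact: den_notin.
rewrite -!(hom_res phi); congr (phi W _); apply: sectionsP => y.
have [[Vy Vy'] /principal_openP uy] := set_mem (valP y).
have [fy ry] := h (Defs.incl WU y) Vy; have [fy' ry'] := h' (Defs.incl WU y) Vy'.
by rewrite /= ry ry'; apply/frac_eqP; exists (Denom uy).
Qed.

Definition extends_at (U : opens R) (s : div_sections U) (t : H U) : Prop :=
  forall (V : opens R) (VU : V `<=` U) (r : sections M V),
    div_res VU s = section_div r -> pres H VU t = phi V r.

Lemma extension_exists (U : opens R) (s : div_sections U) : exists t, extends_at s t.
Proof.
(* All opens with a lift of [s] to [tilde M] are taken at once, so the glued section satisfies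
   [extends_at] without comparing coverings. *)
pose I := {Vr : {V : opens R & sections M V} |
  exists VU : projT1 Vr `<=` U, div_res VU s = section_div (projT2 Vr)}.
pose V (i : I) := projT1 (sval i).
pose r (i : I) : sections M (V i) := projT2 (sval i).
have VU (i : I) : V i `<=` U by have [] := svalP i.
have rE (i : I) : div_res (VU i) s = section_div (r i).
  by have [VUi <-] := svalP i; congr (div_res _ s); exact: Prop_irrelevance.
have cov : div_cover U V.
  move=> x Ux; have [W [WU [q [Wx e]]]] := to_div_tilde_locally_surj s Ux.
  have hW : exists VU : W `<=` U, div_res VU s = section_div q by exists WU.
  by exists (exist _ (existT _ W q) hW).
have [i j|t [ht _]] := shH VU cov (s := fun i => phi (V i) (r i)).
  rewrite -!(hom_res phi); apply: hom_factors_div; apply: div_sectionsP => x Vx.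
  have Vxi : codim_le1 (V i) x by case: Vx => -[].
  have Vxj : codim_le1 (V j) x by case: Vx => -[].
  have /(congr1 (fun t : div_sections _ => t x Vxi)) /= ei := rE i.
  have /(congr1 (fun t : div_sections _ => t x Vxj)) /= ej := rE j.
  rewrite /= (germ_irr (r i) _ (mem_set Vxi.1)) (germ_irr (r j) _ (mem_set Vxj.1)).
  by rewrite -ei -ej; exact: div_germ_irr.
exists t => W WU q e.
have hW : exists VU : W `<=` U, div_res VU s = section_div q by exists WU.
have := ht (exist _ (existT _ W q) hW); rewrite /V /r /= => <-.
by congr (pres H _ t); exact: Prop_irrelevance.
Qed.

Definition extension (U : opens R) (s : div_sections U) : H U :=
  sval (cid (extension_exists s)).

Lemma extensionP (U : opens R) (s : div_sections U) : extends_at s (extension s).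
Proof. exact: svalP (cid (extension_exists s)). Qed.

Lemma div_res_comp (U V W : opens R) (VU : V `<=` U) (WV : W `<=` V) (WU : W `<=` U)
  (s : div_sections U) : div_res WU s = div_res WV (div_res VU s).
Proof. exact: (@pres_comp R div_tilde). Qed.

Lemma section_div_res (U V : opens R) (VU : V `<=` U) (r : sections M U) :
  section_div (section_res VU r) = div_res VU (section_div r).
Proof. exact: (hom_res to_div_tilde). Qed.

Lemma extension_linear (U : opens R) : linear (@extension U).
Proof.
move=> a s s'; apply: div_sheaf_separated => x Ux.
have [V [VU [r [Vx e]]]] := to_div_tilde_locally_surj s Ux.
have [V' [VU' [r' [Vx' e']]]] := to_div_tilde_locally_surj s' Ux.
pose W := opens_cap V V'.
have WV : W `<=` V by move=> y [].
have WV' : W `<=` V' by move=> y [].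
have WU : W `<=` U by move=> y /WV/VU.
have ew : div_res WU s = section_div (section_res WV r).
  by rewrite (div_res_comp VU WV) e section_div_res.
have ew' : div_res WU s' = section_div (section_res WV' r').
  by rewrite (div_res_comp VU' WV') e' section_div_res.
exists W, WU; split=> //; rewrite linearP (extensionP ew) (extensionP ew') -linearP.
by apply: extensionP; rewrite !linearP /= ew ew'.
Qed.

Lemma extension_res (U V : opens R) (VU : V `<=` U) (s : div_sections U) :
  extension (div_res VU s) = pres H VU (extension s).
Proof.
apply: div_sheaf_separated => x Vx.
have [W [WV [r [Wx e]]]] := to_div_tilde_locally_surj (div_res VU s) Vx.
exists W, WV; split=> //; rewrite (extensionP e).
have WU : W `<=` U by move=> y /WV/VU.
by rewrite -(pres_comp VU WV WU); apply/esym/extensionP; rewrite (div_res_comp VU WV).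
Qed.

Lemma extension_section_div (U : opens R) (r : sections M U) :
  extension (section_div r) = phi U r.
Proof.
rewrite -[LHS](pres_id (fun x => id)); apply: extensionP.
exact: (@pres_id R div_tilde).
Qed.

Lemma div_tilde_hom_exists :
  exists psi : presheaf_hom div_tilde H, forall U s, psi U (to_div_tilde U s) = phi U s.
Proof.
pose g U := cid (linear_of (@extension_linear U)).
have hg (U V : opens R) (VU : V `<=` U) (s : div_tilde U) :
    sval (g V) (pres div_tilde VU s) = pres H VU (sval (g U) s).
  by rewrite !(svalP (g _)); exact: extension_res.
exists (@PresheafHom R div_tilde H (fun U => sval (g U)) hg) => U s /=.
by rewrite (svalP (g U)); exact: extension_section_div.
Qed.

Lemma div_tilde_hom_unique (psi psi' : presheaf_hom div_tilde H) :
  (forall U s, psi U (to_div_tilde U s) = phi U s) ->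
  (forall U s, psi' U (to_div_tilde U s) = phi U s) ->
  forall U s, psi U s = psi' U s.
Proof.
move=> h h' U s; apply: div_sheaf_separated => x Ux.
have [V [VU [r [Vx e]]]] := to_div_tilde_locally_surj s Ux.
exists V, VU; split=> //; rewrite -(hom_res psi) -(hom_res psi').
by have -> : pres div_tilde VU s = to_div_tilde V r by []; rewrite h h'.
Qed.

End UniversalProperty.

Lemma div_tilde_sheafification : div_sheafification to_div_tilde.
Proof.
split=> [|H phi shH]; first exact: div_tilde_sheaf.
by split; [exact: div_tilde_hom_exists | exact: div_tilde_hom_unique].
Qed.

End DivSections.

(** * Global sections and the bidual *)

Section DualFun.
Variables (R : comNzRingType) (M : lmodType R) (phi : dual M).

Lemma dual_linear : linear (dual_fun phi : M -> R^o).
Proof. exact: linearP (phi : {linear M -> R^o}). Qed.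

Lemma dualZ a m : dual_fun phi (a *: m) = a * dual_fun phi m.
Proof. by rewrite /dual_fun linearZ. Qed.

Lemma dual_sum n (F : 'I_n -> M) :
  dual_fun phi (\sum_i F i) = \sum_i dual_fun phi (F i).
Proof. by rewrite /dual_fun raddf_sum. Qed.

End DualFun.

Section GlobalSections.
Variables (R : idomainType) (M : lmodType R).
Hypotheses (noethR : noetherian R) (normalR : normal_domain R).
Hypotheses (finM : finite_module M) (tfM : torsion_free M).

Lemma spec_neq0 (x : spec R) a : a \notin in_prime x -> a != 0.
Proof. by apply: contraNneq => ->; case: (spec_ideal x). Qed.

Lemma is_frac_neq0 (x : spec R) (m : M) a (z : loc x M) : is_frac m a z -> a != 0.
Proof. by move=> [ax _]; exact: spec_neq0 ax. Qed.

(** A dual basis at the generic point expresses a nonzero multiple of [m - n] through the values of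
    forms on it. *)
Lemma dual_separates m n : (forall phi : dual M, dual_fun phi m = dual_fun phi n) -> m = n.
Proof.
move=> mn; have [k [g [phi [s [s0 hs]]]]] :=
  codim1_dual_basis noethR normalR finM tfM (@generic_dim_le1 R).
have /tfM[s0'|/eqP] : s *: (m - n) = 0.
- by rewrite scalerBr !hs -sumrB big1 // => i _; rewrite mn subrr.
- by move: (spec_neq0 s0); rewrite s0' eqxx.
- by rewrite subr_eq0 => /eqP.
Qed.

(** The cross-multiplied form of [phi m / a = phi n / b]. *)
Lemma is_frac_dual (x : spec R) (z : loc x M) m n a b (phi : dual M) :
  is_frac m a z -> is_frac n b z -> b * dual_fun phi m = a * dual_fun phi n.
Proof.
move=> [ax ->] [bx] /frac_eqP[u /= /(congr1 (dual_fun phi))].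
by rewrite !dualZ; apply: mulfI; exact: spec_neq0 (den_notin u).
Qed.

Lemma is_frac_eq_dual (x : spec R) (z w : loc x M) m n a b :
  is_frac m a z -> is_frac n b w ->
  (forall phi : dual M, b * dual_fun phi m = a * dual_fun phi n) -> z = w.
Proof.
move=> [ax ->] [bx ->] mn; apply/frac_eqP; exists (denom1 x); congr (_ *: _) => /=.
by apply: dual_separates => phi; rewrite !dualZ.
Qed.

Lemma codim_le1X (x : spec R) : krull_dim_le (local_ring x) 1 -> codim_le1 (openX R) x.
Proof. by []. Qed.

Lemma open_generic (V : opens R) x : oset V x -> oset V (generic_point R).
Proof.
have := osetP V; rewrite zariski_openE => -[E VE].
by rewrite VE => -[f Ef fx]; exists f => //; rewrite in_generic (spec_neq0 fx).
Qed.

Let X := openX R.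

Lemma div_germ_frac (U : opens R) (s : div_sections M U) x (Ux : codim_le1 U x) :
  exists m a, is_frac m a (s x Ux).
Proof.
by have [V [m [a [_ Vx h]]]] := div_germ_locally_frac s Ux; exists m, a; exact: h.
Qed.

(** A fraction representing [s] near a point also represents it at the generic point, where all
    values are compared. *)
Lemma div_germ_dual (s : div_sections M X) x y (Xx : codim_le1 X x) (Xy : codim_le1 X y)
    m n a b (phi : dual M) :
  is_frac m a (s x Xx) -> is_frac n b (s y Xy) -> b * dual_fun phi m = a * dual_fun phi n.
Proof.
have Xo := codim_le1X (@generic_dim_le1 R).
have [k [c ko]] := div_germ_frac s Xo.
have c0 := is_frac_neq0 ko.
have gen z (Xz : codim_le1 X z) l d : is_frac l d (s z Xz) ->
    c * dual_fun phi l = d * dual_fun phi k.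
  move=> lz; have [V [l' [d' [_ Vz h]]]] := div_germ_locally_frac s Xz.
  have lz' := h z Xz Vz; have lo := h _ Xo (open_generic Vz).
  have d0 := is_frac_neq0 lz'.
  apply: (mulfI d0).
  by rewrite mulrCA (is_frac_dual phi lz lz') mulrCA (is_frac_dual phi lo ko) mulrCA.
move=> ma nb; have [hm hn] := (gen _ _ _ _ ma, gen _ _ _ _ nb); apply: (mulfI c0).
by rewrite mulrCA hm mulrCA -hn mulrCA.
Qed.

(* [phi s] lies in [R_p] for all primes [p] of codimension at most one. *)
Lemma dual_value_exists (s : div_sections M X) (phi : dual M) :
  exists r, forall x (Xx : codim_le1 X x) m a, is_frac m a (s x Xx) ->
    dual_fun phi m = r * a.
Proof.
have Xo := codim_le1X (@generic_dim_le1 R).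
have [k [c ko]] := div_germ_frac s Xo.
have c0 := is_frac_neq0 ko.
(* The value at the generic point is [phi k / c]; a fraction for [s] at [p] rewrites it with a
   denominator outside [p]. *)
have [|r hr] := dvd_of_codim1 noethR normalR (a := dual_fun phi k) c0.
  move=> p dimp; have [m [a ma]] := div_germ_frac s (codim_le1X dimp).
  exists a; first by case: ma.
  by exists (dual_fun phi m); rewrite (div_germ_dual phi ma ko).
exists r => x Xx m a ma; apply: (mulfI c0).
by rewrite (div_germ_dual phi ma ko) hr; ring.
Qed.

Definition dual_value (s : div_sections M X) (phi : dual M) : R^o :=
  sval (cid (dual_value_exists s phi)).

Lemma dual_valueP (s : div_sections M X) phi x (Xx : codim_le1 X x) m a :
  is_frac m a (s x Xx) -> dual_fun phi m = dual_value s phi * a.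
Proof. exact: (svalP (cid (dual_value_exists s phi))). Qed.

Lemma dual_value_unique (s : div_sections M X) phi x (Xx : codim_le1 X x) m a r :
  is_frac m a (s x Xx) -> dual_fun phi m = r * a -> dual_value s phi = r.
Proof.
move=> ma hr; have a0 := is_frac_neq0 ma.
by apply: (mulIf a0); rewrite -hr (dual_valueP phi ma).
Qed.

Lemma dual_value_linear s : linear (dual_value s).
Proof.
move=> c phi psi; have [m [a ma]] := div_germ_frac s (codim_le1X (@generic_dim_le1 R)).
apply: (dual_value_unique ma); rewrite mulrDl -mulrA.
by rewrite -!(dual_valueP _ ma).
Qed.

Lemma dual_value_linear_section c (s t : div_sections M X) phi :
  dual_value (c *: s + t) phi = c * dual_value s phi + dual_value t phi.
Proof.
have Xo := codim_le1X (@generic_dim_le1 R).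
have [[m [a ma]] [n [b nb]]] := (div_germ_frac s Xo, div_germ_frac t Xo).
have st := is_fracD (is_fracZ c ma) nb.
apply: (@dual_value_unique (c *: s + t) phi _ Xo _ _ _ st).
rewrite dual_linear /GRing.scale /= !dualZ (dual_valueP phi ma) (dual_valueP phi nb).
by ring.
Qed.

Lemma sections_to_bidual_exists :
  exists f : {linear div_sections M X -> bidual M},
    forall s phi, dual_fun (f s) phi = dual_value s phi.
Proof.
have [F hF] := choice (fun s => linear_of (@dual_value_linear s)).
have linF : linear (F : div_sections M X -> bidual M).
  move=> c s t; apply: dualP => phi.
  by rewrite /dual_fun hF dual_value_linear_section -!hF.
have [f hf] := linear_of linF.
by exists f => s phi; rewrite hf /dual_fun hF.
Qed.

(** The dual basis expands [s *: psi] in the forms [phi i] with coefficients [psi (g i)]; applying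
    [Phi] shows that [s * Phi psi] is [psi] of the sum of the [Phi (phi i) *: g i]. *)
Lemma bidual_locally_frac (Phi : bidual M) (x : spec R) :
  krull_dim_le (local_ring x) 1 ->
  exists m a, a \notin in_prime x /\
    forall phi : dual M, dual_fun phi m = a * dual_fun Phi phi.
Proof.
move=> /(codim1_dual_basis noethR normalR finM tfM)[n [g [phi [s [sx hs]]]]].
exists (\sum_i dual_fun Phi (phi i) *: g i), s; split=> // psi.
have spsi : s *: psi = \sum_i dual_fun psi (g i) *: phi i.
  apply: dualP => m.
  have -> : dual_fun (s *: psi) m = s * dual_fun psi m by [].
  have -> : dual_fun (\sum_i dual_fun psi (g i) *: phi i) m =
      \sum_i dual_fun psi (g i) * dual_fun (phi i) m.
    by elim/big_rec2: _ => // i y1 y2 _ <-.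
  by rewrite -dualZ hs dual_sum; apply: eq_bigr => i _; rewrite dualZ mulrC.
rewrite -dualZ spsi !dual_sum; apply: eq_bigr => i _.
by rewrite !dualZ mulrC.
Qed.

Lemma sections_to_bidual_inj (s t : div_sections M X) :
  dual_value s =1 dual_value t -> s = t.
Proof.
move=> st; apply: div_sectionsP => x Xx.
have [[m [a ma]] [n [b nb]]] := (div_germ_frac s Xx, div_germ_frac t Xx).
apply: (is_frac_eq_dual ma nb) => phi.
by rewrite (dual_valueP phi ma) (dual_valueP phi nb) st; ring.
Qed.

(** The germs are chosen independently, yet all have the values prescribed by [Phi]; as forms
    separate, the fraction chosen at [x] gives the germ at every [y] where its denominator does not
    vanish. *)
Lemma sections_to_bidual_surj (Phi : bidual M) :
  exists s : div_sections M X, forall phi, dual_value s phi = dual_fun Phi phi.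
Proof.
have loc_ x (Xx : codim_le1 X x) : {z : loc x M | exists m a, is_frac m a z /\
    forall phi : dual M, dual_fun phi m = a * dual_fun Phi phi}.
  apply: cid; have [m [a [ax h]]] := bidual_locally_frac Phi Xx.2.
  by exists (frac m (Denom ax)), m, a; split=> //; exists ax.
have sP : div_locally_frac (fun x (Xx : codim_le1 X x) => sval (loc_ x Xx)).
  move=> x Xx; have [m [a [[ax _] h]]] := svalP (loc_ x Xx).
  exists (principal_open a), m, a; split=> //; first exact/principal_openP.
  move=> y Xy /principal_openP ay; have [n [b [nb k]]] := svalP (loc_ y Xy).
  have ma : is_frac m a (frac m (Denom ay)) by exists ay.
  rewrite (is_frac_eq_dual nb ma) // => phi.
  by rewrite h k; ring.
exists (DivSections sP) => phi.
have Xo := codim_le1X (@generic_dim_le1 R).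
have [m [a [ma h]]] := svalP (loc_ _ Xo).
by apply: (dual_value_unique (s := DivSections sP) ma); rewrite h mulrC.
Qed.

Lemma div_tilde_global_sections :
  exists f : {linear div_tilde M X -> bidual M},
    bijective f /\ forall m, f (to_div_tilde M X (section_of X m)) = to_bidual m.
Proof.
have [f hf] := sections_to_bidual_exists.
exists f; split=> [|m].
  have [g hg] := choice sections_to_bidual_surj.
  exists g => [s|Phi]; last by apply: dualP => phi; rewrite hf hg.
  by apply: sections_to_bidual_inj => phi; rewrite hg hf.
apply: dualP => phi; rewrite hf.
have Xo := codim_le1X (@generic_dim_le1 R).
apply: (dual_value_unique (Xx := Xo) (m := m) (a := 1)); first exact: is_frac1.
by rewrite mulr1.
Qed.

End GlobalSections.

(** * Uniqueness of the sheafification *)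

Section Universal.
Variables (R : comNzRingType) (F : presheaf R).

Lemma presheaf_id_hom (G : presheaf R) :
  exists h : presheaf_hom G G, forall U s, h U s = s.
Proof.
by exists (@PresheafHom R G G (fun U => idfun) (fun U V VU s => erefl)).
Qed.

Lemma presheaf_comp_hom (G H K : presheaf R) (h : presheaf_hom G H) (k : presheaf_hom H K) :
  exists l : presheaf_hom G K, forall U s, l U s = k U (h U s).
Proof.
pose l U : {linear G U -> K U} := k U \o h U.
have lres (U V : opens R) (VU : V `<=` U) s : l V (pres G VU s) = pres K VU (l U s).
  by rewrite /l /= !hom_res.
by exists (PresheafHom lres).
Qed.

(** The composite of [h] and [k] and the identity both extend [eta] along itself, so universality
    identifies them. *)
Lemma div_sheafification_retract (G H : presheaf R) (eta : presheaf_hom F G)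
    (theta : presheaf_hom F H) (h : presheaf_hom G H) (k : presheaf_hom H G) :
  div_sheafification eta ->
  (forall U s, h U (eta U s) = theta U s) -> (forall U s, k U (theta U s) = eta U s) ->
  forall U, cancel (h U) (k U).
Proof.
move=> [shG uniG] hE kE U s.
have [i hi] := presheaf_id_hom G; have [l hl] := presheaf_comp_hom h k.
have [_ uniq] := uniG _ eta shG.
by rewrite -hl -[RHS]hi; apply: uniq => V t; [rewrite hl hE kE | rewrite hi].
Qed.

Lemma div_sheafification_iso (G H : presheaf R) (eta : presheaf_hom F G)
    (theta : presheaf_hom F H) :
  div_sheafification eta -> div_sheafification theta ->
  exists h : presheaf_hom G H,
    (forall U s, h U (eta U s) = theta U s) /\ forall U, bijective (h U).
Proof.
move=> sG sH; have [[h hE] _] := sG.2 _ theta sH.1.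
have [[k kE] _] := sH.2 _ eta sG.1.
exists h; split=> // U; exists (k U).
  exact: (div_sheafification_retract sG hE kE).
exact: (div_sheafification_retract sH kE hE).
Qed.

End Universal.

Theorem lemma6p4p2 (R : idomainType) (M : lmodType R) :
  noetherian R -> normal_domain R ->
  finite_module M -> torsion_free M ->
  (exists (Mdiv : presheaf R) (eta : presheaf_hom (tilde M) Mdiv),
     div_sheafification eta) /\
  forall (Mdiv : presheaf R) (eta : presheaf_hom (tilde M) Mdiv),
    div_sheafification eta ->
    exists f : {linear Mdiv (openX R) -> bidual M},
      bijective f /\
      forall m : M, f (eta (openX R) (section_of (openX R) m)) = to_bidual m.
Proof.
move=> noethR normalR finM tfM; split.
  by exists (div_tilde M), (to_div_tilde M); exact: div_tilde_sheafification.
(* An arbitrary sheafification is isomorphic to the explicit one, compatibly with the maps from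
   [tilde M]. *)
move=> Mdiv eta sh.
have [h [hE hbij]] := div_sheafification_iso sh (div_tilde_sheafification M).
have [f [fbij fE]] := div_tilde_global_sections noethR normalR finM tfM.
exists (f \o h (openX R)); split=> [|m]; first exact: bij_comp fbij (hbij _).
by rewrite /= hE fE.
Qed.
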